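(* Let $r\geq 4$ be an integer and let $n\geq R(K_r)$ be an integer. Then \[R(c(nK_r)) = (r^2 - r + 1)n - r + 1.\]
   Context: $K_m$ denotes the complete graph on $m$ vertices. $R(K_r)$ is the classical Ramsey number: the least $N$ such that every colouring of the edges of $K_N$ with two colours contains a monochromatic copy of $K_r$. For a graph $H$, $nH$ denotes the disjoint union of $n$ copies of $H$. $R(c(nK_r))$ denotes the least integer $N$ such that every colouring of the edges of $K_N$ with two colours (red and blue) contains, for some colour $c$, $n$ pairwise vertex-disjoint copies of $K_r$ all of whose edges have colour $c$ and which all lie in a single connected component of the spanning subgraph formed by the edges of colour $c$. *)

(* Defs.v *)
From mathcomp Require Import all_boot.
From mathcomp Require Import zify.

Set Implicit Arguments.
Unset Strict Implicit.
Unset Printing Implicit Defensive.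

Notation edge V := {A : {set V} | #|A| == 2}.

(* Of the two colours, [true] may be read as red and [false] as blue. *)
Notation colouring V := {ffun edge V -> bool}.

Section Colourings.

Variable V : finType.
Implicit Type f : colouring V.

Definition colour_graph (f : colouring V) (c : bool) : rel V :=
  fun x y => [exists e : edge V, (val e == [set x; y]) && (f e == c)].

Definition component (f : colouring V) (c : bool) (z : V) : {set V} :=
  [set x | connect (colour_graph f c) z x].

Definition mono_clique (f : colouring V) (c : bool) (r : nat) (A : {set V}) :=
  (#|A| == r) &&
  [forall x in A, forall y in A, (x != y) ==> colour_graph f c x y].

Definition has_mono_clique (r : nat) (f : colouring V) : bool :=
  [exists c : bool, exists A : {set V}, mono_clique f c r A].

Definition has_connected_mono_copies (n r : nat) (f : colouring V) : bool :=
  [exists c : bool, exists K : {ffun 'I_n -> {set V}},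
    [&& [forall i, mono_clique f c r (K i)],
        [forall i, forall j, (i != j) ==> [disjoint K i & K j]]
      & [exists z, forall i, K i \subset component f c z]]].

End Colourings.

Definition ramsey_prop (r N : nat) : bool :=
  [forall f : colouring 'I_N, has_mono_clique r f].

Definition conn_ramsey_prop (n r N : nat) : bool :=
  [forall f : colouring 'I_N, has_connected_mono_copies n r f].

Section Existence.

Variable V : finType.
Implicit Types (f : colouring V) (A B : {set V}).

Lemma colour_graph_neq f c x y : colour_graph f c x y -> x != y.
Proof.
case/existsP=> e /andP[/eqP ee _]; move: (valP e); rewrite ee cards2.
by case: (x != y).
Qed.

Lemma colour_graph_sym f c : symmetric (colour_graph f c).
Proof. by move=> x y; rewrite /colour_graph setUC. Qed.

Lemma colour_graph_total f x y : x != y ->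
  colour_graph f true x y || colour_graph f false x y.
Proof.
move=> xy; have e2 : #|[set x; y]| == 2 by rewrite cards2 xy.
case fE : (f (exist _ [set x; y] e2)); apply/orP; [left|right];
by apply/existsP; exists (exist _ [set x; y] e2); rewrite fE /= !eqxx.
Qed.

Lemma colour_graphN f c x y : colour_graph f (~~ c) x y ->
  ~~ colour_graph f c x y.
Proof.
case/existsP=> e /andP[/eqP ee /eqP fe].
apply/negP=> /existsP[e' /andP[/eqP ee' /eqP]].
have -> : e' = e by apply: val_inj; rewrite ee ee'.
by rewrite fe; case: c {fe}.
Qed.

Lemma mono_cliqueP f c r A :
  reflect (#|A| = r /\ {in A &, forall x y, x != y -> colour_graph f c x y})
          (mono_clique f c r A).
Proof.
apply: (iffP andP) => -[cA hA]; split; try exact/eqP.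
  move=> x y xA yA xy.
  by move/forall_inP: hA => /(_ x xA) /forall_inP /(_ y yA); rewrite xy.
apply/forall_inP=> x xA; apply/forall_inP=> y yA; apply/implyP; exact: hA.
Qed.

Lemma mono_cliqueS f c r A x :
  mono_clique f c r A -> {in A, forall y, colour_graph f c x y} ->
  mono_clique f c r.+1 (x |: A).
Proof.
case/mono_cliqueP=> cA hA xA.
have nxA : x \notin A by apply/negP=> /xA /colour_graph_neq; rewrite eqxx.
apply/mono_cliqueP; split; first by rewrite cardsU1 nxA cA.
move=> u v /setU1P[->|uA] /setU1P[->|vA] uv; last exact: hA.
- by rewrite eqxx in uv.
- exact: xA.
- by rewrite colour_graph_sym; apply: xA.
Qed.

Lemma ramsey_off_diagonal f s t A : 2 ^ (s + t) <= #|A| ->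
  exists2 B : {set V}, B \subset A &
    mono_clique f true s B || mono_clique f false t B.
Proof.
have clique0 c : mono_clique f c 0 set0.
  by apply/mono_cliqueP; split=> [|x y]; rewrite ?cards0 ?inE.
have [k] := ubnP (s + t); elim: k s t A => // k IHk [|s] [|t] A ltk hA;
  try by exists set0; rewrite ?sub0set ?clique0 ?orbT.
have /card_gt0P[x xA] : 0 < #|A| by apply: leq_trans hA; rewrite expn_gt0.
pose nb c := [set y in A | colour_graph f c x y].
have nbA c : nb c \subset A by apply/subsetP=> y; rewrite inE => /andP[].
have sub : A :\ x \subset nb true :|: nb false.
  apply/subsetP=> y; rewrite !inE => /andP[yx yA]; rewrite yA /=.
  by apply: colour_graph_total; rewrite eq_sym.
have hx := cardsD1 x A; rewrite xA in hx.
have hU := leq_trans (subset_leq_card sub) (leq_card_setU _ _).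
have E : 2 ^ (s.+1 + t.+1) = 2 ^ (s + t.+1) + 2 ^ (s + t.+1).
  by rewrite addSn expnS mul2n addnn.
have E' : 2 ^ (s + t.+1) = 2 ^ (s.+1 + t) by rewrite addnS addSn.
have [h|h] : 2 ^ (s + t.+1) <= #|nb true| \/ 2 ^ (s.+1 + t) <= #|nb false|
  by lia.
- have [|B sB /orP[hB|hB]] := IHk s t.+1 _ _ h; first by lia.
  + exists (x |: B).
      by rewrite subUset sub1set xA (subset_trans sB (nbA _)).
    by rewrite mono_cliqueS // => y /(subsetP sB); rewrite inE => /andP[].
  + by exists B; rewrite ?hB ?orbT // (subset_trans sB (nbA _)).
- have [|B sB /orP[hB|hB]] := IHk s.+1 t _ _ h; first by lia.
  + by exists B; rewrite ?hB // (subset_trans sB (nbA _)).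
  + exists (x |: B).
      by rewrite subUset sub1set xA (subset_trans sB (nbA _)).
    by rewrite orbC mono_cliqueS // => y /(subsetP sB); rewrite inE => /andP[].
Qed.

Lemma ramsey_diagonal f r : 2 ^ (r + r) <= #|V| -> has_mono_clique r f.
Proof.
rewrite -cardsT => /(ramsey_off_diagonal f)[B _ /orP[]hB].
  by apply/existsP; exists true; apply/existsP; exists B.
by apply/existsP; exists false; apply/existsP; exists B.
Qed.

Lemma mono_clique_copies f n r :
  has_mono_clique (n * r).+1 f -> has_connected_mono_copies n r f.
Proof.
case/existsP=> c /existsP[A /mono_cliqueP[cA hA]].
have [z zA] : exists z, z \in A by apply/card_gt0P; rewrite cA.
pose s := enum A.
have us : uniq s by rewrite enum_uniq.
have ss : size s = (n * r).+1 by rewrite -cardE.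
pose g (i : 'I_n) (k : 'I_r) := nth z s (i * r + k).
have lt_g (i : 'I_n) (k : 'I_r) : i * r + k < size s.
  by rewrite ss; have := ltn_ord i; have := ltn_ord k; nia.
have gA i k : g i k \in A by rewrite -mem_enum mem_nth.
have g_inj i k j l : g i k = g j l -> i = j /\ k = l.
  move/eqP; rewrite nth_uniq // => /eqP E.
  have Ei : i = j :> nat.
    have := congr1 (divn^~ r) E.
    have r0 : 0 < r by have := ltn_ord k; lia.
    by rewrite !divnMDl // !divn_small ?ltn_ord // !addn0.
  by split; apply: val_inj => //=; move: E; rewrite Ei => /addnI.
pose K := [ffun i => [set g i k | k : 'I_r]].
have KA i : K i \subset A.
  by rewrite ffunE; apply/subsetP=> _ /imsetP[k _ ->].
apply/existsP; exists c; apply/existsP; exists K; apply/and3P; split.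
- apply/forallP=> i; apply/mono_cliqueP; split.
    by rewrite ffunE card_imset ?card_ord // => k l /g_inj[].
  by move=> x y /(subsetP (KA i)) xA /(subsetP (KA i)); exact: hA.
- apply/forallP=> i; apply/forallP=> j; apply/implyP=> ij.
  rewrite !ffunE disjoint_subset; apply/subsetP=> _ /imsetP[k _ ->].
  rewrite inE; apply/imsetP=> -[l _ /g_inj[eij _]].
  by rewrite eij eqxx in ij.
- apply/existsP; exists z; apply/forallP=> i.
  apply/subsetP=> x /(subsetP (KA i)) xA; rewrite inE.
  have [->|zx] := eqVneq z x; first exact: connect0.
  by apply: connect1; apply: hA.
Qed.

End Existence.

Lemma ramsey_exists r : exists N, ramsey_prop r N.
Proof.
exists (2 ^ (r + r)); apply/forallP=> f.
by apply: ramsey_diagonal; rewrite card_ord.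
Qed.

Lemma conn_ramsey_exists n r : exists N, conn_ramsey_prop n r N.
Proof.
have [N /forallP hN] := ramsey_exists (n * r).+1; exists N.
by apply/forallP=> f; apply: mono_clique_copies.
Qed.

(* R(K_r) *)
Definition ramsey (r : nat) : nat := ex_minn (ramsey_exists r).

(* R(c(nK_r)) *)
Definition conn_ramsey (n r : nat) : nat := ex_minn (conn_ramsey_exists n r).

(* Main.v *)
(** One colour class, say blue, is connected. Split the vertices into red
    components, and call a component [A] without [n] disjoint red [K_r] good for
    [p] if it contains [n] disjoint blue cliques of balanced sizes with [p]
    vertices in total. All edges between red components are blue, so the cliques
    of different components can be merged and the values of [p] add up; [p = r n]
    in total gives [n] blue copies of [K_r]. A component with [|A| < n] is good
    for [|A|]. If [n <= |A| < (r + 1) n], it is good for [n + t], where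
    [t = max (0, |A| - (r n - 1))], because it has a blue matching of size [t].
    If [|A|] is larger, it is good for [s n], where [s = ceil (|A| / (r n - 1))]
    (cut off at [r]): for [s >= 3], extract monochromatic cliques greedily, which
    is where [n >= R(K_r)] and [r >= 4] enter. So, with multiplicity [k = 0],
    [1] or [s] respectively, [p >= k n] and [|A| <= p + k ((r - 1) n - 1)] (unless
    [k >= r]); summing over the components gives [p >= r n]. *)
Require Import Defs.
From mathcomp Require Import all_boot.
From mathcomp Require Import zify.

Set Implicit Arguments.
Unset Strict Implicit.
Unset Printing Implicit Defensive.

(** * Colourings induced by symmetric relations *)

Section ColouringOfRel.

Variables (V : finType) (q : rel V).

(** An edge is an unordered pair, so some ordering of its ends has to satisfy [q]; [x != y] keeps
    reflexive instances of [q] out. *)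
Definition colouring_of : colouring V :=
  [ffun e : edge V => [exists x in val e, exists y in val e, (x != y) && q x y]].

Lemma colour_graph_of c x y : symmetric q ->
  colour_graph colouring_of c x y = (x != y) && (q x y == c).
Proof.
move=> q_sym.
have E (e : edge V) : val e = [set x; y] -> x != y -> colouring_of e = q x y.
  move=> ee xy; rewrite ffunE ee; apply/exists_inP/idP => [[u hu]|qxy].
    case/exists_inP=> v hv /andP[uv quv].
    case/set2P: hu uv quv => ->; case/set2P: hv => ->; rewrite ?eqxx //.
    by rewrite q_sym.
  exists x; first exact: set21.
  by apply/exists_inP; exists y; rewrite ?set22 ?xy.
apply/idP/andP => [gxy|[xy /eqP qxy]].
  have xy := colour_graph_neq gxy; split=> //.
  by case/existsP: gxy => e /andP[/eqP ee]; rewrite (E e ee xy).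
have e2 : #|[set x; y]| == 2 by rewrite cards2 xy.
apply/existsP; exists (exist _ [set x; y] e2).
by rewrite eqxx (E (exist _ [set x; y] e2)) // qxy eqxx.
Qed.

End ColouringOfRel.

Lemma ramseyP r : ramsey_prop r (ramsey r).
Proof. by rewrite /ramsey; case: ex_minnP. Qed.

(** Yields [4 <= n] later; any colouring, here a constant one, exhibits [r] distinct vertices. *)
Lemma leq_ramsey r : r <= ramsey r.
Proof.
have /forallP/(_ [ffun=> true])/existsP[c /existsP[A /mono_cliqueP[cA _]]] :=
  ramseyP r.
by rewrite -{1}cA -[leqRHS]card_ord max_card.
Qed.

(** * Greedy extraction of disjoint monochromatic cliques *)

Section Packings.

Variables (V : finType) (f : colouring V).
Implicit Types (c : bool) (A B K : {set V}) (L : seq {set V}).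

Lemma colour_graph_or c x y : x != y ->
  colour_graph f c x y \/ colour_graph f (~~ c) x y.
Proof. by move/(colour_graph_total f)/orP; case: c => -[]; auto. Qed.

Lemma mono_clique_sub c r s A : s <= r -> mono_clique f c r A ->
  exists2 B : {set V}, B \subset A & mono_clique f c s B.
Proof.
move=> sr /mono_cliqueP[cA hA].
have [B BA sB] : exists2 B : {set V}, B \subset A & #|B| = s.
  move: sr; rewrite -cA => /card_geqP[l [ul sl lA]].
  exists [set x in l]; last by rewrite cardsE (card_uniqP ul).
  by apply/subsetP=> x; rewrite inE; apply: lA.
exists B => //; apply/mono_cliqueP; split=> // x y xB yB.
by apply: hA; apply: (subsetP BA).
Qed.

(** Pulls the colouring back to ['I_(ramsey r)] along an injection into [A]. *)
Lemma mono_clique_ramsey r A : ramsey r <= #|A| ->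
  exists c, exists2 K : {set V}, K \subset A & mono_clique f c r K.
Proof.
move=> rA.
pose g (i : 'I_(ramsey r)) : V := enum_val (widen_ord rA i).
have g_inj : injective g by move=> i j /enum_val_inj[] /val_inj.
pose q : rel 'I_(ramsey r) := fun i j => colour_graph f true (g i) (g j).
have q_sym : symmetric q by move=> i j; rewrite /q colour_graph_sym.
have /forallP/(_ (colouring_of q))/existsP[c] := ramseyP r.
case/existsP=> K /mono_cliqueP[cK hK]; exists c, (g @: K).
  by apply/subsetP=> _ /imsetP[i _ ->]; apply: enum_valP.
apply/mono_cliqueP; split; first by rewrite card_imset.
move=> _ _ /imsetP[i iK ->] /imsetP[j jK ->] gij.
have /hK/(_ jK) := iK; rewrite colour_graph_of // -(inj_eq g_inj) gij.
move=> /(_ isT)/= /eqP; have := colour_graph_total f gij.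
by rewrite /q; case: c {hK}; case: colour_graph => //=.
Qed.

Definition disjoint_cliques c k r A L :=
  [&& size L == k, all (fun K => mono_clique f c r K && (K \subset A)) L
    & pairwise (fun K K' => [disjoint K & K']) L].

Definition has_copies c k r A := exists L, disjoint_cliques c k r A L.

Lemma has_copies0 c r A : has_copies c 0 r A.
Proof. by exists [::]. Qed.

Lemma has_copiesS c k r A B : A \subset B -> has_copies c k r A ->
  has_copies c k r B.
Proof.
move=> AB [L /and3P[sL aL dL]]; exists L; apply/and3P; split=> //.
by apply: sub_all aL => K /andP[-> /subset_trans->].
Qed.

Lemma has_copies_cons c k r A B K : mono_clique f c r K -> K \subset A ->
  B \subset A -> [disjoint K & B] -> has_copies c k r B ->
  has_copies c k.+1 r A.
Proof.
move=> hK KA BA dKB [L /and3P[/eqP sL /allP hL dL]]; exists (K :: L).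
rewrite /disjoint_cliques /= sL eqxx hK KA dL /= andbT; apply/andP; split.
  by apply/allP=> K' /hL /andP[-> /subset_trans->].
apply/allP=> K' /hL /andP[_ K'B].
by rewrite disjoint_sym; apply: disjointWl K'B _; rewrite disjoint_sym.
Qed.

(** [B] may exceed [K], so that further vertices can be discarded along with the clique. *)
Lemma has_copiesD c k r A K B : mono_clique f c r K -> K \subset A ->
  K \subset B -> has_copies c k r (A :\: B) -> has_copies c k.+1 r A.
Proof.
move=> hK KA KB; apply: (has_copies_cons hK KA (subsetDl A B)).
by rewrite disjoint_sym; apply: (disjointWr KB); rewrite disjoints_subset subsetDr.
Qed.

Lemma has_copies_clique c n r A : n * r <= #|A| ->
  {in A &, forall x y, x != y -> colour_graph f c x y} -> has_copies c n r A.
Proof.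
elim: n A => [|n IHn] A cA hA; first exact: has_copies0.
have [||K KA hK] := @mono_clique_sub c #|A| r A; first by lia.
  exact/mono_cliqueP.
have /mono_cliqueP[cK _] := hK.
apply: (has_copiesD hK KA (subxx _)); apply: IHn.
  by rewrite cardsD (setIidPr KA) cK; lia.
by move=> x y /setDP[xA _] /setDP[yA _]; apply: hA.
Qed.

Lemma has_copies_greedy c r s a b A : 0 < a -> 0 < b -> s <= r ->
  a * r + b * s + ramsey r <= #|A| + r + s ->
  has_copies c a r A \/ has_copies (~~ c) b s A.
Proof.
move=> + + sr; have [k] := ubnP (a + b).
elim: k a b A => // k IHk [|a] [|b] A ltk // _ _ hA.
have [|d [K KA hK]] := @mono_clique_ramsey r A; first by nia.
have /mono_cliqueP[cK _] := hK.
have [Ed|Ed] : d = c \/ d = ~~ c by case: (d) (c) => -[]; auto.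
  rewrite Ed in hK; have [a0|a0] := posnP a.
    by left; rewrite a0; apply: has_copiesD hK KA (subxx _) (has_copies0 _ _ _).
  have [||||hr|hb] := IHk a b.+1 (A :\: K) => //;
    rewrite ?cardsD ?(setIidPr KA) ?cK; try by nia.
    by left; apply: has_copiesD hK KA (subxx _) hr.
  by right; apply: has_copiesS (subsetDl _ _) hb.
have [K' K'K hK'] := mono_clique_sub sr hK.
have K'A := subset_trans K'K KA; have /mono_cliqueP[cK' _] := hK'.
rewrite Ed in hK'; have [b0|b0] := posnP b.
  by right; rewrite b0; apply: has_copiesD hK' K'A (subxx _) (has_copies0 _ _ _).
have [||||hr|hb] := IHk a.+1 b (A :\: K') => //;
  rewrite ?cardsD ?(setIidPr K'A) ?cK'; try by nia.
  by left; apply: has_copiesS (subsetDl _ _) hr.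
by right; apply: has_copiesD hK' K'A (subxx _) hb.
Qed.

Lemma mono_clique2 c x y : colour_graph f c x y -> mono_clique f c 2 [set x; y].
Proof.
move=> gxy; apply/mono_cliqueP; split.
  by rewrite cards2 (colour_graph_neq gxy).
move=> u v /set2P[]-> /set2P[]->; rewrite ?eqxx // => _.
by rewrite colour_graph_sym.
Qed.

Lemma clique_or_edge c A :
  {in A &, forall x y, x != y -> colour_graph f c x y} \/
  exists x y, [/\ x \in A, y \in A & colour_graph f (~~ c) x y].
Proof.
have [/existsP[x /existsP[y /and3P[]]]|/existsPn H] :=
  boolP [exists x, exists y, [&& x \in A, y \in A & colour_graph f (~~ c) x y]].
  by right; exists x, y.
left=> x y xA yA /(colour_graph_or c)[//|gxy].
by have /existsPn/(_ y) := H x; rewrite xA yA gxy.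
Qed.

(** Edges of colour [~~ c] are removed greedily. Before each of the [m] removals at least [r]
    vertices are left; with no such edge among them they form a clique of colour [c]. *)
Lemma clique_or_matching c r m A : 0 < m -> 2 * m + r <= #|A| + 2 ->
  (exists2 K : {set V}, K \subset A & mono_clique f c r K) \/
  has_copies (~~ c) m 2 A.
Proof.
elim: m A => // m IHm A _ hA.
have [clA|[x [y [xA yA gxy]]]] := clique_or_edge c A.
  by left; apply: (@mono_clique_sub c #|A|); [lia|apply/mono_cliqueP].
have hK := mono_clique2 gxy.
have KA : [set x; y] \subset A by rewrite subUset !sub1set xA.
have [m0|m0] := posnP m.
  by right; rewrite m0; apply: has_copiesD hK KA (subxx _) (has_copies0 _ _ _).
have [|[B BA hB]|?] := IHm (A :\: [set x; y]) m0.
- by rewrite cardsD (setIidPr KA) cards2 (colour_graph_neq gxy); lia.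
- by left; exists B => //; apply: subset_trans BA (subsetDl _ _).
- by right; apply: has_copiesD hK _ (subxx _) _.
Qed.

(* While some blue edge meets some red K_r, delete both: this costs r + 1
   vertices and one from each of [n] and [t]. Otherwise a red K_r sends only red
   edges, so every vertex lies in a red K_r and hence no blue edge exists. *)
Lemma copies_or_matching c r n t A : 1 < r -> t <= n ->
  r * n + t <= #|A| + 1 -> has_copies c n r A \/ has_copies (~~ c) t 2 A.
Proof.
move=> r1; elim: n t A => [|n IHn] [|t] A // tn hA;
  try by [left; apply: has_copies0 | right; apply: has_copies0].
have [||[K KA hK]|] := @clique_or_matching c r t.+1 A; try by nia.
  2: by right.
have [/existsP[B /existsP[x /existsP[y /and5P[BA hB xB yA gxy]]]]|/existsPn H] :=
  boolP [exists B : {set V}, exists x, exists y, [&& B \subset A,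
    mono_clique f c r B, x \in B, y \in A & colour_graph f (~~ c) x y]].
  have /mono_cliqueP[cB clB] := hB.
  have BA' : y |: B \subset A by rewrite subUset sub1set yA.
  have eB : [set x; y] \subset y |: B.
    by rewrite subUset !sub1set !inE eqxx xB orbT.
  have [||hr|hb] := IHn t (A :\: (y |: B)) => //.
  - rewrite cardsD (setIidPr BA') cardsU1 cB.
    have : #|y |: B| <= #|A| by apply: subset_leq_card.
    by rewrite cardsU1 cB; case: (y \notin B) => /=; nia.
  - by left; apply: has_copiesD hB BA (subsetUr _ _) hr.
  - by right; apply: has_copiesD (mono_clique2 gxy) (subset_trans eB BA') eB hb.
have {}H B x y : B \subset A -> mono_clique f c r B -> x \in B -> y \in A ->
    x != y -> colour_graph f c x y.
  move=> BA hB xB yA /(colour_graph_or c)[//|gxy].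
  by have /existsPn/(_ x)/existsPn/(_ y) := H B; rewrite BA hB xB yA gxy.
left; apply: has_copies_clique => [|x y xA yA xy]; first by nia.
have /mono_cliqueP[cK clK] := hK.
have [xK|xK] := boolP (x \in K); first exact: H hK _ _ _.
have [|B BK hB] := @mono_clique_sub c r r.-1 K _ hK; first by lia.
have hxB : mono_clique f c r (x |: B).
  rewrite -(ltn_predK r1); apply: mono_cliqueS => // z zB.
  have zK := subsetP BK z zB.
  rewrite colour_graph_sym; apply: (H K) => //.
  by apply: contraNneq xK => <-.
apply: H hxB _ yA xy; last by rewrite !inE eqxx.
by rewrite subUset sub1set xA (subset_trans BK).
Qed.

(** * Balanced packings of cliques *)

(* [n] disjoint cliques of balanced sizes, listed in round-robin order: the
   positions of each clique form a class mod [n]. Concatenation thus merges two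
   packings with no reindexing. *)
Definition packing c n A p := exists g : nat -> V,
  [/\ forall j, j < p -> g j \in A,
      {in gtn p &, injective g} &
      forall j k, j < p -> k < p -> j != k -> j = k %[mod n] ->
        colour_graph f c (g j) (g k)].

Lemma packing_trunc c n A p p' : p' <= p -> packing c n A p -> packing c n A p'.
Proof.
move=> pp [g [gA gI gB]]; exists g; split.
- by move=> j jp; apply: gA; lia.
- by move=> j k; rewrite !inE => jp kp; apply: gI; rewrite inE; lia.
- by move=> j k jp kp; apply: gB; lia.
Qed.

(** Shifting by [p] preserves congruence mod [n], and pairs across have colour [c] anyway. [A] and
    [B] are disjoint since no vertex is joined to itself. *)
Lemma packing_cat c n A B p p' :
  {in A & B, forall x y, colour_graph f c x y} ->
  packing c n A p -> packing c n B p' -> packing c n (A :|: B) (p + p').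
Proof.
move=> AB [g [gA gI gB]] [h [hA hI hB]].
have AB' j k : j < p -> k < p' -> colour_graph f c (g j) (h k).
  by move=> jp kp; apply: AB; [apply: gA|apply: hA].
exists (fun j => if j < p then g j else h (j - p)); split.
- move=> j jp; rewrite inE; case: ltnP => jp'; first by rewrite gA.
  by rewrite hA ?orbT //; lia.
- move=> j k; rewrite !inE => jp kp; case: ltnP => jp'; case: ltnP => kp' E.
  + exact: gI.
  + by have /colour_graph_neq := AB' j (k - p) jp' ltac:(lia); rewrite E eqxx.
  + by have /colour_graph_neq := AB' k (j - p) kp' ltac:(lia); rewrite E eqxx.
  + suff: j - p = k - p by lia.
    by apply: hI; rewrite ?inE //; lia.
- move=> j k jp kp jk E; case: ltnP => jp'; case: ltnP => kp'.
  + exact: gB.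
  + by apply: AB'; lia.
  + by rewrite colour_graph_sym; apply: AB'; lia.
  + apply: hB; try lia.
    by apply/eqP; rewrite -(eqn_modDr p) !subnK //; apply/eqP.
Qed.

(** Positions below [n] have distinct residues, so single vertices suffice. *)
Lemma packing_small c n A p (x0 : V) : p <= n -> p <= #|A| -> packing c n A p.
Proof.
move=> pn pA; exists (nth x0 (enum A)); split.
- by move=> j jp; rewrite -mem_enum mem_nth // -cardE; lia.
- move=> j k; rewrite !inE => jp kp /eqP.
  by rewrite nth_uniq ?enum_uniq -?cardE //; [move/eqP|lia|lia].
- by move=> j k jp kp /eqP jk; rewrite !modn_small //; lia.
Qed.

(** Position [j] holds vertex number [j %/ n] of clique number [j %% n]; the last hypothesis says
    that this vertex exists. *)
Lemma packing_cliques c n A L p (x0 : V) :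
  (forall K, K \in L -> K \subset A /\ mono_clique f c #|K| K) ->
  pairwise (fun K K' => [disjoint K & K']) L ->
  (forall j, j < p -> j %/ n < #|nth set0 L (j %% n)|) -> packing c n A p.
Proof.
move=> hL dL hp.
pose K j := nth set0 L (j %% n).
(* The default [set0] has no vertices, so [hp] keeps the index in range. *)
have jL j : j < p -> j %% n < size L.
  move/hp; apply: contraTT; rewrite -!leqNgt => ?.
  by rewrite nth_default ?cards0.
have KL j : j < p -> K j \in L by move=> /jL; apply: mem_nth.
pose g j := nth x0 (enum (K j)) (j %/ n).
have gK j : j < p -> g j \in K j.
  by move=> jp; rewrite -mem_enum mem_nth // -cardE; apply: hp.
have gE j k : j < p -> k < p -> g j = g k -> j = k %[mod n].
  move=> jp kp E; apply/eqP; apply: contraT => ne.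
  have dd (a b : nat) : a < b < size L -> [disjoint nth set0 L a & nth set0 L b].
    by case/andP=> ab bL; move/(pairwiseP set0): dL; apply; rewrite ?inE //; lia.
  have gj := gK j jp; have gk := gK k kp; rewrite -E in gk.
  have [lt|lt|E'] := ltngtP (j %% n) (k %% n); last by rewrite E' eqxx in ne.
    have /pred0P/(_ (g j)) := dd _ _ (introT andP (conj lt (jL k kp))).
    by rewrite /= gj gk.
  have /pred0P/(_ (g j)) := dd _ _ (introT andP (conj lt (jL j jp))).
  by rewrite /= gj gk.
have gI : {in gtn p &, injective g}.
  move=> j k; rewrite !inE => jp kp E; have Em := gE j k jp kp E.
  have EK : K j = K k by rewrite /K Em.
  move/eqP: E; rewrite /g EK nth_uniq ?enum_uniq -?cardE //.
  - by move/eqP=> Ed; rewrite (divn_eq j n) (divn_eq k n) Ed Em.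
  - by rewrite -EK; apply: hp.
  - exact: hp.
exists g; split=> //.
- by move=> j jp; apply: (subsetP (hL _ (KL j jp)).1); apply: gK.
- move=> j k jp kp jk E; have [_ /mono_cliqueP[_]] := hL _ (KL j jp); apply.
  + exact: gK.
  + by rewrite /K E; apply: gK.
  + by apply: contraNneq jk => /gI ->.
Qed.

Lemma packing_copies c n s A (x0 : V) : 0 < n -> has_copies c n s A ->
  packing c n A (s * n).
Proof.
move=> n0 [L /and3P[/eqP sL /allP hL dL]].
have hL' K : K \in L -> mono_clique f c s K /\ K \subset A.
  by move/hL/andP.
apply: (@packing_cliques _ _ _ L) => // [K /hL'[hK KA]|j jp].
  by have /mono_cliqueP[cK _] := hK; rewrite cK.
have /hL'[/mono_cliqueP[-> _] _] : nth set0 L (j %% n) \in L.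
  by rewrite mem_nth // sL ltn_mod.
by rewrite ltn_divLR.
Qed.

(** The [t] edges are listed first, then at least [n - t] single vertices. Positions [n] to
    [n + t - 1], the second round, thus fall on the edges. *)
Lemma packing_matching c n t A (x0 : V) : 0 < n -> t <= n -> n + t <= #|A| ->
  has_copies c t 2 A -> packing c n A (n + t).
Proof.
move=> n0 tn cA [L /and3P[/eqP sL /allP hL dL]].
pose U := \bigcup_(K <- L) K.
have KU K : K \in L -> K \subset U by move=> KL; rewrite /U (big_rem K KL) subsetUl.
have cU : #|U| <= 2 * t.
  rewrite -sL /U; elim: L {dL sL U KU} hL => [|K L IH] hL.
    by rewrite big_nil cards0.
  rewrite big_cons (leq_trans (leq_card_setU _ _)) //.
  have /andP[/mono_cliqueP[-> _] _] := hL K (mem_head _ _).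
  by have := IH (fun B BL => hL B (@mem_behead _ (K :: L) B BL)); rewrite /=; lia.
pose L' := [seq [set x] | x <- enum (A :\: U)].
have cL' : n - t <= size L'.
  rewrite size_map -cardE cardsD.
  have : #|A :&: U| <= #|U| by apply: subset_leq_card; apply: subsetIr.
  lia.
apply: (@packing_cliques _ _ _ (L ++ L')) => // [K|| j jp].
- rewrite mem_cat => /orP[/hL/andP[hK KA]|].
    by have /mono_cliqueP[cK _] := hK; rewrite cK.
  case/mapP=> x; rewrite mem_enum => /setDP[xA _] ->.
  rewrite sub1set xA; split=> //; apply/mono_cliqueP; split=> // u v.
  by rewrite !inE => /eqP-> /eqP->; rewrite eqxx.
- rewrite pairwise_cat dL /=; apply/andP; split.
    apply/allrelP=> K K' KL /mapP[x]; rewrite mem_enum => /setDP[_ xU] ->.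
    rewrite disjoint_sym disjoints1; apply: contra xU.
    exact: (subsetP (KU _ KL)).
  rewrite pairwise_map; have := enum_uniq (A :\: U).
  rewrite uniq_pairwise; apply: sub_pairwise => x y /= xy.
  by rewrite disjoints1 inE.
- rewrite nth_cat sL; case: (ltnP (j %% n) t) => jt.
    have /hL/andP[/mono_cliqueP[-> _] _] : nth set0 L (j %% n) \in L.
      by rewrite mem_nth // sL.
    by rewrite ltn_divLR //; lia.
  have jn : j < n.
    rewrite ltnNge; apply/negP=> nj.
    by move: jt; rewrite -(subnK nj) modnDr modn_small; lia.
  rewrite modn_small // in jt *; rewrite divn_small //.
  have : nth set0 L' (j - t) \in L'.
    by rewrite mem_nth //; apply: leq_trans cL'; lia.
  by case/mapP=> x _ ->; rewrite cards1.
Qed.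

(** * Components of one colour and the upper bound *)

(** If colour [true] is disconnected, all edges between a component [U] and its complement are
    [false], and these alone connect everything. *)
Lemma mono_connected : exists c, forall x y, connect (colour_graph f c) x y.
Proof.
have sym c := sym_connect_sym (@colour_graph_sym V f c).
have [/forallP H|/forallPn[x /forallPn[y nxy]]] :=
  boolP [forall x, forall y, connect (colour_graph f true) x y].
  by exists true => x y; apply/forallP: y.
pose U := component f true x.
have xU : x \in U by rewrite inE connect0.
have yU : y \notin U by rewrite inE.
have B u v : u \in U -> v \notin U -> connect (colour_graph f false) u v.
  rewrite !inE => uU vU; apply: connect1.
  have uv : u != v by apply: contraNneq vU => <-.
  have [g|//] := colour_graph_or true uv.
  by case/negP: vU; apply: connect_trans uU (connect1 g).
have By u : connect (colour_graph f false) u y.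
  have [uU|uU] := boolP (u \in U); first exact: B.
  by apply: connect_trans (B x y xU yU); rewrite sym; apply: B.
by exists false => u v; apply: connect_trans (By u) _; rewrite sym.
Qed.

(** Here [c] is red. The bound on [#|A|] is linear in [p] and [k], hence additive over components,
    and exact for [s]: [s (r n - 1) = s n + s ((r - 1) n - 1)]. *)
Lemma component_packing c n r A (x0 : V) : 4 <= r -> ramsey r <= n ->
  ~ has_copies c n r A ->
  exists k p, [/\ packing (~~ c) n A p, k * n <= p
    & #|A| <= p + k * ((r - 1) * n - 1) \/ r <= k].
Proof.
move=> r4 rn nA.
have n4 : 4 <= n by apply: leq_trans rn; apply: leq_trans (leq_ramsey r).
have [An|nAc] := ltnP #|A| n.
  exists 0, #|A|; split=> //; last by left; lia.
  by apply: packing_small => //; apply: ltnW.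
have [le|gt] := leqP (#|A| + 1) (r.+1 * n).
  pose t := #|A| - (r * n - 1).
  exists 1, (n + t); split; [|lia|left; nia].
  have [t0|t0] := posnP t.
    by rewrite t0 addn0; apply: packing_small.
  apply: packing_matching => //; try by nia.
  by have [|||//|//] := @copies_or_matching c r n t A => //; nia.
(* For [s = 2] the greedy bound is too weak, but a blue matching of [n] edges exists. *)
have [le2|gt2] := leqP #|A| (2 * (r * n - 1)).
  exists 2, (2 * n); split=> //; last by left; nia.
  apply: packing_copies => //; first by lia.
  by have [|||//|//] := @copies_or_matching c r n n A => //; nia.
have [s [s3 sr sA As]] : exists s, [/\ 3 <= s, s <= r,
    (s - 1) * (r * n - 1) < #|A| & #|A| <= s * (r * n - 1) \/ r <= s].
  have [le|gt3] := leqP #|A| (r * (r * n - 1)); last first.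
    exists r; split; [lia|by []| |by right].
    by apply: leq_ltn_trans gt3; rewrite leq_mul2r leq_subr orbT.
  have d0 : 0 < r * n - 1 by clear -r4 n4; nia.
  move: (r * n - 1) le gt2 d0 => d le gt2 d0.
  (* Dividing [#|A| - 1] makes [u + 1] the ceiling of [#|A| / d]. *)
  have Ed := divn_eq (#|A| - 1) d; have := ltn_pmod (#|A| - 1) d0.
  set u := _ %/ d in Ed *; set v := _ %% d in Ed * => vd.
  exists u.+1; split; try (left; rewrite mulSn); rewrite ?subn1 /=; try lia.
    by rewrite ltnS leq_divRL //; lia.
  by rewrite ltn_divLR //; lia.
exists s, (s * n); split=> //.
  apply: packing_copies => //; first by lia.
  have [||||//|//] := @has_copies_greedy c r s n n A; try by lia.
  (* As [ramsey r <= n], it suffices that [(s - 2) r >= s + 1]; for [r >= 4] this follows from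
     [4 (s - 2) >= s + 1], that is, [s >= 3]. *)
  have [u Es] : exists u, s = u + 3 by exists (s - 3); lia.
  have : (u + 1) * (4 * n) <= (u + 1) * (r * n).
    by rewrite leq_mul2l leq_mul2r r4 !orbT.
  move: sA; rewrite {}Es mulnBr => sA; clear -n4 r4 rn sA; nia.
case: As => As; [left|by right].
by apply: leq_trans As _; rewrite mulnBr mulnBr mulnBl mulnBr; clear; nia.
Qed.

(** Closed sets are unions of components, so induction can split off one component [C] at a time. No
    edge of colour [c] leaves [C], hence [packing_cat] applies. *)
Lemma closed_packing c n r A (x0 : V) : 4 <= r -> ramsey r <= n ->
  (forall x, ~ has_copies c n r (component f c x)) ->
  closed (colour_graph f c) A ->
  exists k p, [/\ packing (~~ c) n A p, k * n <= p
    & #|A| <= p + k * ((r - 1) * n - 1) \/ r <= k].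
Proof.
move=> r4 rn hC; have sym := sym_connect_sym (@colour_graph_sym V f c).
have [m] := ubnP #|A|; elim: m A => // m IHm A ltm clA.
have [->|[x xA]] := set_0Vmem A.
  exists 0, 0; split=> //; last by left; rewrite cards0.
  exact: packing_small.
pose C := component f c x.
have CA : C \subset A.
  by apply/subsetP=> y; rewrite inE => /(closed_connect clA) <-.
have clC : closed (colour_graph f c) C.
  apply: (intro_closed sym) => y z yz; rewrite !inE => xy.
  exact: connect_trans xy (connect1 yz).
have clD : closed (colour_graph f c) (A :\: C).
  by move=> y z yz; rewrite !in_setD (clA _ _ yz) (clC _ _ yz).
have cC : 0 < #|C| by apply/card_gt0P; exists x; rewrite inE connect0.
have cA : #|A| = #|C| + #|A :\: C|.
  by rewrite cardsD (setIidPr CA) subnKC // subset_leq_card.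
have [|k [p [hp kp dp]]] := IHm (A :\: C) _ clD; first by lia.
have [k' [p' [hp' kp' dp']]] := component_packing x0 r4 rn (hC x).
exists (k' + k), (p' + p); split; [|lia|]; last first.
  by move: ((r - 1) * n - 1) dp dp' => D; rewrite -/C cA mulnDl; lia.
have -> : A = C :|: (A :\: C).
  by rewrite -{1}(setID A C) (setIidPr CA).
apply: packing_cat => // y z yC /setDP[_ zC].
have yz : y != z by apply: contraNneq zC => <-.
have [g|//] := colour_graph_or c yz.
by rewrite (clC _ _ g) in yC; rewrite yC in zC.
Qed.

Lemma has_copies_connected c n r A z : A \subset component f c z ->
  has_copies c n r A -> has_connected_mono_copies n r f.
Proof.
move=> Az [L /and3P[/eqP sL /allP hL dL]].
have iL (i : 'I_n) : nth set0 L i \in L by rewrite mem_nth ?sL.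
have dd (i j : 'I_n) : i < j -> [disjoint nth set0 L i & nth set0 L j].
  by move=> ij; move/(pairwiseP set0): dL; apply; rewrite ?inE ?sL.
apply/existsP; exists c; apply/existsP; exists [ffun i : 'I_n => nth set0 L i].
apply/and3P; split.
- by apply/forallP=> i; rewrite ffunE; have /andP[] := hL _ (iL i).
- apply/forallP=> i; apply/forallP=> j; apply/implyP=> ij; rewrite !ffunE.
  have [lt|lt|/val_inj E] := ltngtP i j; first exact: dd.
    by rewrite disjoint_sym; apply: dd.
  by rewrite E eqxx in ij.
- apply/existsP; exists z; apply/forallP=> i; rewrite ffunE.
  by have /andP[_ /subset_trans->] := hL _ (iL i).
Qed.

(** Below [r * n] each residue [i] mod [n] has exactly [r] positions, [k * n + i] with [k < r]. *)
Lemma packing_connected c n r A z : A \subset component f c z ->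
  packing c n A (r * n) -> has_connected_mono_copies n r f.
Proof.
move=> Az [g [gA gI gB]].
pose h (i : 'I_n) (k : 'I_r) := g (k * n + i).
have lt_h (i : 'I_n) (k : 'I_r) : k * n + i < r * n.
  by have := ltn_ord i; have := ltn_ord k; nia.
have h_inj i k j l : h i k = h j l -> i = j /\ k = l.
  move=> /gI; rewrite !inE => /(_ (lt_h _ _) (lt_h _ _)) E.
  have n0 : 0 < n by have := ltn_ord i; lia.
  split; apply: val_inj.
    by have := congr1 (modn^~ n) E; rewrite !modnMDl !modn_small.
  by have := congr1 (divn^~ n) E; rewrite !divnMDl // !divn_small ?addn0.
apply/existsP; exists c; apply/existsP.
exists [ffun i : 'I_n => [set h i k | k : 'I_r]]; apply/and3P; split.
- apply/forallP=> i; rewrite ffunE; apply/mono_cliqueP; split.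
    by rewrite card_imset ?card_ord // => k l /h_inj[].
  move=> _ _ /imsetP[k _ ->] /imsetP[l _ ->] kl; apply: gB => //.
    by apply: contraNneq kl; rewrite /h => ->.
  by rewrite !modnMDl.
- apply/forallP=> i; apply/forallP=> j; apply/implyP=> ij; rewrite !ffunE.
  rewrite disjoint_subset; apply/subsetP=> _ /imsetP[k _ ->].
  rewrite inE; apply/imsetP=> -[l _ /h_inj[E _]].
  by rewrite E eqxx in ij.
- apply/existsP; exists z; apply/forallP=> i; rewrite ffunE.
  apply/subsetP=> _ /imsetP[k _ ->]; apply: (subsetP Az); exact: gA.
Qed.

Lemma connected_copies n r : 4 <= r -> ramsey r <= n ->
  (r - 1) * (r * n - 1) + n <= #|V| -> has_connected_mono_copies n r f.
Proof.
move=> r4 rn cV.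
have n4 : 4 <= n by apply: leq_trans rn; apply: leq_trans (leq_ramsey r).
have /card_gt0P[x0 _] : 0 < #|V|.
  by rewrite (leq_trans _ cV) // ltn_addl //; lia.
(* This [c] is the connected colour, so [~~ c] takes the role of red in [closed_packing]. *)
have [c conn] := mono_connected.
apply: contraT => no.
have hC x : ~ has_copies (~~ c) n r (component f (~~ c) x).
  by move/(has_copies_connected (subxx _)); apply/negP.
have [//|k [p [hp kp dp]]] := @closed_packing (~~ c) n r [set: V] x0 r4 rn hC.
  by move=> x y _; rewrite !inE.
rewrite negbK in hp; rewrite cardsT in dp.
case/negP: no; apply: (@packing_connected c n r [set: V] x0).
  by apply/subsetP=> x _; rewrite inE.
apply: packing_trunc hp; have [rk|kr] := leqP r k.
  by apply: leq_trans kp; rewrite leq_mul2r rk orbT.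
case: dp => [dp|]; last by rewrite leqNgt kr.
(* For [k <= r - 1] the two bounds on [#|V|] leave [p >= (r - 1) n + n = r n]. *)
have hk : k * ((r - 1) * n - 1) <= (r - 1) * ((r - 1) * n - 1).
  by rewrite leq_mul2r; apply/orP; right; lia.
have := leq_trans (leq_trans cV dp) (leq_add (leqnn p) hk).
case: r r4 {rn hC kr cV dp hk} => // r r4; rewrite subn1 /= !mulnBr.
clear -n4; nia.
Qed.

End Packings.

(** * The block colouring and the lower bound *)

Lemma leq_card_disjoint (T : finType) (n a : nat) (K : 'I_n -> {set T})
    (S : {set T}) :
  (forall i j, i != j -> [disjoint K i & K j]) ->
  (forall i, a <= #|K i|) -> (forall i, K i \subset S) -> n * a <= #|S|.
Proof.
move=> dK cK KS; apply: (@leq_trans #|\bigcup_i K i|); last first.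
  by apply: subset_leq_card; apply/bigcupsP.
rewrite -sum1_card partition_disjoint_bigcup // -[n in leqLHS]card_ord.
by rewrite -sum_nat_const; apply: leq_sum => i _; rewrite sum1_card.
Qed.

Lemma card_ord_interval m a b : #|[set x : 'I_m | a <= x < a + b]| <= b.
Proof.
rewrite cardE -(size_map val) -[leqRHS](size_iota a); apply: uniq_leq_size.
  by rewrite map_inj_uniq ?enum_uniq //; apply: val_inj.
by move=> y /mapP[x + ->]; rewrite mem_enum inE mem_iota.
Qed.

(* The blocks are red cliques of [r * n - 1] vertices each, the last one cut off
   after [n - 1] vertices, and all edges between blocks are blue. A red
   component is too small, and each blue K_r needs a vertex of the last block. *)
Lemma block_colouring_no_copies r n m : 1 < r -> 0 < n ->
  m < (r - 1) * (r * n - 1) + n ->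
  exists f : colouring 'I_m, ~~ has_connected_mono_copies n r f.
Proof.
move=> r1 n0 hm.
pose d := r * n - 1; have d0 : 0 < d by rewrite /d; nia.
pose block (x : 'I_m) := x %/ d.
pose q : rel 'I_m := fun x y => block x == block y.
have q_sym : symmetric q by move=> x y; rewrite /q eq_sym.
exists (colouring_of q).
apply/negP=> /existsP[c /existsP[K /and3P[/forallP hK /forallP dK]]].
case/existsP=> z /forallP Kz.
have {}dK i j : i != j -> [disjoint K i & K j].
  by move=> ij; have /forallP/(_ j)/implyP/(_ ij) := dK i.
have cK i : #|K i| = r by have /mono_cliqueP[] := hK i.
case: c hK Kz => hK Kz.
  pose S := [set x : 'I_m | block z * d <= x < block z * d + d].
  have ES x : (x \in S) = (block x == block z).
    by rewrite inE -leq_divRL // -mulSnr -ltn_divLR // ltnS eqn_leq andbC.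
  have clS : closed (colour_graph (colouring_of q) true) S.
    move=> u v; rewrite colour_graph_of // !ES => /andP[_ /eqP].
    by rewrite /q => /eqP ->.
  have KS i : K i \subset S.
    apply/subsetP=> x /(subsetP (Kz i)); rewrite inE.
    by move/(closed_connect clS) <-; rewrite ES.
  have h := @leq_card_disjoint _ n r K S dK (fun i => eq_leq (esym (cK i))) KS.
  have := leq_trans h (card_ord_interval m (block z * d) d).
  by move: d0; rewrite mulnC /d; lia.
pose S := [set x : 'I_m | (r - 1) * d <= x < (r - 1) * d + (n - 1)].
have KS i : 0 < #|K i :&: S|.
  rewrite card_gt0; apply: contraT; rewrite negbK => /eqP KS0.
  (* Missing the last block leaves [r - 1] blocks, and a blue clique has at most one vertex in
     each. *)
  have lt_block x : x \in K i -> block x < r - 1.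
    move=> xK; rewrite ltn_divLR // ltnNge; apply/negP=> hx.
    have : x \in K i :&: S.
      by rewrite !inE xK hx; have := ltn_ord x; rewrite /d; lia.
    by rewrite KS0 inE.
  have block_inj : {in K i &, injective block}.
    move=> x y xK yK E; apply/eqP; apply: contraT => xy.
    have /mono_cliqueP[_ /(_ x y xK yK xy)] := hK i.
    by rewrite colour_graph_of // /q E eqxx andbF.
  have : size (map block (enum (K i))) <= size (iota 0 (r - 1)).
    apply: uniq_leq_size.
      rewrite map_inj_in_uniq ?enum_uniq // => x y; rewrite !mem_enum.
      exact: block_inj.
    by move=> y /mapP[x + ->]; rewrite mem_enum mem_iota => /lt_block.
  by rewrite size_map -cardE cK size_iota; lia.
have dKS i j : i != j -> [disjoint K i :&: S & K j :&: S].
  by move/dK; apply: disjointW; apply: subsetIl.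
have := leq_card_disjoint dKS KS (fun i => subsetIr (K i) S).
by move/leq_trans/(_ (card_ord_interval _ _ _)); lia.
Qed.

Theorem theorem1p1 (r n : nat) (hr : 4 <= r) (hn : ramsey r <= n) :
  conn_ramsey n r = (r ^ 2 - r + 1) * n - r + 1.
Proof.
have n4 : 4 <= n by apply: leq_trans hn; apply: leq_trans (leq_ramsey r).
(* One more than the block colouring can hold: [r - 1] full blocks and [n - 1] further vertices. *)
have -> : (r ^ 2 - r + 1) * n - r + 1 = (r - 1) * (r * n - 1) + n.
  by rewrite -mulnn; nia.
rewrite /conn_ramsey; case: ex_minnP => N /forallP hN minN.
apply/eqP; rewrite eqn_leq; apply/andP; split.
  apply: minN; apply/forallP=> f; apply: connected_copies => //.
  by rewrite card_ord.
rewrite leqNgt; apply/negP=> /block_colouring_no_copies[||f]; try by lia.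
by rewrite hN.
Qed.
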